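(* Let $\mathbb{K}$ be a field, let $n\ge 1$, let $\mathcal{X}\subseteq \mathrm{Mat}(n,\mathbb{K})$ be the ring of $n\times n$ X-matrices over $\mathbb{K}$, and let $\mathcal{X}^b=\{A\in\mathcal{X} : A=A^T=A^{\tau}\}$ be the set of bi-symmetric X-matrices. Then $\mathcal{X}^b$ is a commutative subring of $\mathcal{X}$.
   Context: $\mathrm{Mat}(n,\mathbb{K})$ is the ring of $n\times n$ matrices with entries in the field $\mathbb{K}$. A matrix $A=(a_{i,j})\in\mathrm{Mat}(n,\mathbb{K})$ is an X-matrix if $a_{i,j}=0$ whenever $i\neq j$ and $i+j\neq n+1$; the set $\mathcal{X}$ of X-matrices is a subring of $\mathrm{Mat}(n,\mathbb{K})$. The anti-transpose of $A=(a_{i,j})\in \mathrm{Mat}(n,\mathbb{K})$ is the matrix $A^{\tau}$ with entries $(A^{\tau})_{i,j}=a_{n-j+1,\,n-i+1}$. Subrings are unital: they contain the identity matrix. *)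

(* Defs.v *)
From mathcomp Require Import all_boot all_order all_algebra.
Set Implicit Arguments.
Unset Strict Implicit.
Unset Printing Implicit Defensive.
Import GRing.Theory.
Local Open Scope ring_scope.

(* Indices i j : 'I_n are 0-based, so the 1-based condition i + j <> n + 1
   reads i.+1 + j.+1 != n.+1. *)
Definition Xmatrix (K : fieldType) (n : nat) : {pred 'M[K]_n} :=
  [pred A : 'M[K]_n |
    [forall i : 'I_n, forall j : 'I_n,
      (i != j) && (i.+1 + j.+1 != n.+1)%N ==> (A i j == 0)]].

(* rev_ord k has value n - k.+1, i.e. it is the 1-based map k |-> n - k + 1. *)
Definition antitr (K : fieldType) (n : nat) (A : 'M[K]_n) : 'M[K]_n :=
  \matrix_(i, j) A (rev_ord j) (rev_ord i).

Definition bisymXmatrix (K : fieldType) (n : nat) : {pred 'M[K]_n} :=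
  [pred A : 'M[K]_n | [&& A \in @Xmatrix K n, A == A^T & A == antitr A]].

(* The ring structure on 'M[K]_n is the one whose product and unit are *m and
   1%:M, so subring_closed includes membership of the identity matrix; a subring
   of R is a subring of the matrix ring that is contained in R. *)
Definition commutative_subring_of (K : fieldType) (n : nat)
    (R S : {pred 'M[K]_n}) : Prop :=
  [/\ {subset S <= R}, subring_closed S & {in S &, commutative *%R}].

Lemma XmatrixP (K : fieldType) (n : nat) (A : 'M[K]_n) :
  reflect (forall i j : 'I_n, i != j -> (i.+1 + j.+1 != n.+1)%N -> A i j = 0)
          (A \in @Xmatrix K n).
Proof.
apply: (iffP forallP) => [XA i j neq_ij nanti_ij | XA i].
  by apply/eqP; move/forallP/(_ j)/implyP: (XA i); apply; rewrite neq_ij.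
by apply/forallP => j; apply/implyP => /andP[? ?]; rewrite XA.
Qed.

(* The ambient R of commutative_subring_of is a ring for R = Xmatrix. *)
Lemma Xmatrix_subring_closed (K : fieldType) (n : nat) :
  subring_closed (@Xmatrix K n).
Proof.
split.
- by apply/XmatrixP => i j /negPf neq_ij _; rewrite mxE neq_ij.
- move=> A B /XmatrixP XA /XmatrixP XB; apply/XmatrixP => i j neq nanti.
  by rewrite !mxE XA // XB // subrr.
move=> A B /XmatrixP XA /XmatrixP XB; apply/XmatrixP => i j neq nanti.
rewrite mxE big1 // => k _.
have [eq_ik|neq_ik] := eqVneq i k.
  by rewrite -eq_ik (XB i j) ?mulr0.
have [/eqP anti_ik|] := boolP (i.+1 + k.+1 == n.+1)%N; last first.
  by move=> nanti_ik; rewrite XA ?mul0r.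
have [eq_kj|neq_kj] := eqVneq k j.
  by move: nanti; rewrite -eq_kj anti_ik eqxx.
rewrite (XB k j) ?mulr0 //; apply: contra neq => /eqP anti_kj.
apply/eqP/val_inj/succn_inj/eqP.
by rewrite -(eqn_add2r k.+1) anti_ik -anti_kj addnC.
Qed.

(* Main.v *)
Require Import Defs.
From mathcomp Require Import all_boot all_order all_algebra.
Set Implicit Arguments.
Unset Strict Implicit.
Unset Printing Implicit Defensive.
Import GRing.Theory.
Local Open Scope ring_scope.

(** Transposition and anti-transposition are additive, fix the identity and
    reverse products.  So the matrices fixed by both are closed under
    subtraction, and the product of two of them that commute is again fixed by
    both ([fixed_antimorphism_mul]).  Everything therefore rests on
    commutativity.

    A product of X-matrices is an X-matrix, so [A *m B] and [B *m A] need only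
    be compared on the diagonal and on the antidiagonal.  On the diagonal,
    symmetry of [A] and [B] alone makes the entries agree.  A bi-symmetric
    matrix is moreover invariant under the half-turn
    [(i, j) |-> (rev_ord i, rev_ord j)], and reversing the summation index then
    matches the entries on the antidiagonal ([bisymX_comm]). *)

Lemma antitrM (K : fieldType) (n : nat) (A B : 'M[K]_n) :
  antitr (A *m B) = antitr B *m antitr A.
Proof.
apply/matrixP => i j; rewrite !mxE (reindex_inj rev_ord_inj) /=.
by apply: eq_bigr => k _; rewrite !mxE mulrC.
Qed.

Lemma antitrB (K : fieldType) (n : nat) (A B : 'M[K]_n) :
  antitr (A - B) = antitr A - antitr B.
Proof. by apply/matrixP => i j; rewrite !mxE. Qed.

Lemma antitr1 (K : fieldType) (n : nat) : antitr (1%:M : 'M[K]_n) = 1%:M.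
Proof.
by apply/matrixP => i j; rewrite !mxE (inj_eq rev_ord_inj) eq_sym.
Qed.

Lemma bisymXmatrixP (K : fieldType) (n : nat) (A : 'M[K]_n) :
  reflect [/\ A \in @Xmatrix K n, A = A^T & A = antitr A]
          (A \in @bisymXmatrix K n).
Proof.
by apply: (iffP and3P) => -[XA sA aA]; split=> //; apply/eqP.
Qed.

Lemma fixed_antimorphism_mul (K : fieldType) (n : nat)
    (f : 'M[K]_n -> 'M[K]_n) (A B : 'M[K]_n) :
    f (A *m B) = f B *m f A ->
  A = f A -> B = f B -> A *m B = B *m A -> A *m B = f (A *m B).
Proof. by move=> fM Af Bf AB; rewrite fM -Af -Bf. Qed.

Lemma half_turn_bisym (K : fieldType) (n : nat) (A : 'M[K]_n) (i j : 'I_n) :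
  A = A^T -> A = antitr A -> A (rev_ord i) (rev_ord j) = A i j.
Proof. by move=> sA aA; rewrite {2}aA mxE {1}sA mxE. Qed.

Lemma antidiag_rev_ord (n : nat) (i j : 'I_n) :
  (i.+1 + j.+1)%N = n.+1 -> j = rev_ord i.
Proof.
move=> ij; apply/val_inj; rewrite /=.
by apply/eqP; rewrite -(eqn_add2l i.+1) subnKC // -eqSS -addnS ij.
Qed.

(** Off the two diagonals both products vanish because X-matrices form a ring;
    this leaves the entries [(i, i)] and [(i, rev_ord i)]. *)
Lemma bisymX_comm (K : fieldType) (n : nat) :
  {in @bisymXmatrix K n &, commutative (@mulmx K n n n)}.
Proof.
move=> A B /bisymXmatrixP[XA sA aA] /bisymXmatrixP[XB sB aB].
have [_ _ XM] := @Xmatrix_subring_closed K n.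
apply/matrixP => i j.
have [<-|neq_ij] := eqVneq i j.
  rewrite !mxE; apply: eq_bigr => k _.
  by rewrite {1}sA {1}sB !mxE mulrC.
have [/eqP/antidiag_rev_ord ->|nanti] := boolP (i.+1 + j.+1 == n.+1)%N.
  rewrite !mxE (reindex_inj rev_ord_inj); apply: eq_bigr => k _ /=.
  (* B (rev k) (rev i) = B k i = B i k by the half-turn, then symmetry;
     A i (rev k) = A (rev k) i = A k (rev i) by symmetry, then the half-turn. *)
  rewrite (half_turn_bisym _ _ sB aB) {1}sA {1}sB !mxE mulrC.
  by rewrite -(half_turn_bisym (rev_ord k) i sA aA) rev_ordK.
have /XmatrixP -> // := XM _ _ XA XB.
by have /XmatrixP -> // := XM _ _ XB XA.
Qed.

Theorem proposition21 (K : fieldType) (n : nat) (hn : (1 <= n)%N) :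
  commutative_subring_of (@Xmatrix K n) (@bisymXmatrix K n).
Proof.
have [X1 XB XM] := @Xmatrix_subring_closed K n.
split; last exact: bisymX_comm.
  by move=> A /bisymXmatrixP[].
split.
- by apply/bisymXmatrixP; split; rewrite ?trmx1 ?antitr1.
- move=> A B /bisymXmatrixP[XA sA aA] /bisymXmatrixP[XB' sB aB].
  apply/bisymXmatrixP; split; first exact: XB.
    by rewrite linearB /= -sA -sB.
  by rewrite antitrB -aA -aB.
- move=> A B bA bB; have AB := bisymX_comm bA bB.
  move/bisymXmatrixP: bA => [XA sA aA]; move/bisymXmatrixP: bB => [XB' sB aB].
  apply/bisymXmatrixP; split; first exact: XM.
    exact: fixed_antimorphism_mul (trmx_mul A B) sA sB AB.
  exact: fixed_antimorphism_mul (antitrM A B) aA aB AB.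
Qed.
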